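(* Let $G$ be a metabelian $3$-group with abelianization $G/G'$ of type $(3,3)$, of coclass $r=2$ (so $e=r+1=3$), order $|G|=3^n\ge3^5$, nilpotency class $c=m-1\ge3$ with $4\le m=n-1$, and defect of commutativity $k=0$. Let $\mathfrak{A}=\mathfrak{A}(G)\unlhd\mathbb{Z}[X,Y]$ be the annihilator of $G$. Then $$G'\simeq\mathbb{Z}[X,Y]/\mathfrak{A}\simeq A(3,m-2)\oplus C(3)$$ (isomorphisms of groups, the middle term being the additive group of the residue class ring), the direct sum of the nearly homocyclic abelian $3$-group of order $3^{m-2}$ and the cyclic group of order $3$. Therefore $G'$ is precisely of $3$-rank three.
   Context: Nearly homocyclic $3$-groups: for $\mu\ge2$, $A(3,\mu)$ is the abelian group of type $(3^{\mu/2},3^{\mu/2})$ if $\mu$ is even and $(3^{(\mu+1)/2},3^{(\mu-1)/2})$ if $\mu$ is odd. $C(3)$ is the cyclic group of order $3$. Conventions: $[a,b]=a^{-1}b^{-1}ab$, $t^g=g^{-1}tg$; $\gamma_j=\gamma_j(G)$ is the lower central series, $G'=\gamma_2$; $m$ is the index of nilpotency ($\gamma_m=1\ne\gamma_{m-1}$); coclass $r=n-c$. The CF-invariant $e$ is defined by $e+1=\min\{j\ge3:(\gamma_j:\gamma_{j+1})\le3\}$ and equals $r+1$. Put $\chi_j(G)=\{g\in G:[u,g]\in\gamma_{j+2}\ \forall u\in\gamma_j\}$ and $s=\min\{2\le j\le m-1:\chi_j(G)>G'\}$. The defect $k\in\{0,1\}$ is defined by $[\chi_s(G),\gamma_e]=\gamma_{m-k}$.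 Normalized generators $x,y$ of $G$: $\gamma_3=\langle y^3,x^3,\gamma_4\rangle$, $x\in G\setminus\chi_s(G)$ if $s<m-1$, and $y\in\chi_s(G)\setminus G'$. Put $s_2=[y,x]$. Conjugation makes $G'$ a $\mathbb{Z}[G]$-module, $t^{ag+bh}=(t^g)^a(t^h)^b$ (so $t^{x-1}=[t,x]$, $t^{y-1}=[t,y]$; the actions of $x,y$ on $G'$ commute). The annihilator (with respect to normalized generators $x,y$) is the ideal $\mathfrak{A}(G)=\{f\in\mathbb{Z}[X,Y]:s_2^{f(x-1,y-1)}=1\}$. *)

(* Defs.v *)
From HB Require Import structures.
From mathcomp Require Import all_boot all_order all_fingroup all_algebra.
From mathcomp Require Import all_solvable ssrcomplements mpoly.

Set Implicit Arguments.
Unset Strict Implicit.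
Unset Printing Implicit Defensive.

Import GRing.Theory.

Local Open Scope group_scope.

(* 'Z_q only has order q when 1 < q, hence the requirement 2 <= mu.           *)
Definition A3 (mu : nat) : finGroupType :=
  ('Z_(3 ^ uphalf mu) * 'Z_(3 ^ mu./2))%type.

Definition C3 : finGroupType := 'Z_3.

Definition metabelian (gT : finGroupType) (G : {group gT}) : Prop :=
  abelian G^`(1).

Definition nilpotency_index (gT : finGroupType) (G : {group gT}) (m : nat) :
  Prop := 'L_m(G) = 1 /\ 'L_m.-1(G) <> 1.

Definition coclass (gT : finGroupType) (G : {group gT}) : nat :=
  (logn 3 #|G| - nil_class G)%N.

Definition is_least (P : pred nat) (n : nat) : Prop :=
  P n /\ forall j, P j -> (n <= j)%N.

Definition CF_invariant (gT : finGroupType) (G : {group gT}) (e : nat) : Prop :=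
  is_least (fun j => (3 <= j) && (#|'L_j(G) : 'L_j.+1(G)| <= 3))%N e.+1.

Definition chi (gT : finGroupType) (G : {group gT}) (j : nat) : {set gT} :=
  [set g in G | [forall u in 'L_j(G), [~ u, g] \in 'L_j.+2(G)]].

Definition s_invariant (gT : finGroupType) (G : {group gT}) (m s : nat) :
    Prop :=
  is_least (fun j => (2 <= j <= m.-1)%N && (G^`(1) \proper chi G j)) s.

Definition defect (gT : finGroupType) (G : {group gT}) (m e s k : nat) : Prop :=
  (k <= 1)%N /\ [~: chi G s, 'L_e(G)] = 'L_(m - k)(G).

Record normalized_generators (gT : finGroupType) (G : {group gT}) (m s : nat)
    (x y : gT) : Prop := NormalizedGenerators {
  normalized_gen : <<[set x; y]>> = G;
  normalized_L3 : 'L_3(G) = <<[set y ^+ 3; x ^+ 3] :|: 'L_4(G)>>;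
  normalized_x : (s < m.-1)%N -> x \in G :\: chi G s;
  normalized_y : y \in chi G s :\: G^`(1)
}.

Definition zexpg (gT : finGroupType) (t : gT) (a : int) : gT :=
  match a with Posz n => t ^+ n | Negz n => t ^- n.+1 end.

(* t ^ ((x - 1)^i (y - 1)^j), where m = (i, j): since t^(x - 1) = [t, x] and   *)
(* t^(y - 1) = [t, y], this is an iterated commutator.                        *)
Definition monexpg (gT : finGroupType) (x y t : gT) (m : 'X_{1..2}) : gT :=
  iter (m ord_max) (fun u => [~ u, y]) (iter (m ord0) (fun u => [~ u, x]) t).

(* t ^ (f(x - 1, y - 1)), with 'X_ord0 in the role of X and 'X_ord_max in that *)
(* of Y. It is only meaningful for t in an abelian normal subgroup on which    *)
(* the actions of x and y commute; the order of the factors is then immaterial.*)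
Definition polyexpg (gT : finGroupType) (x y t : gT) (f : {mpoly int[2]}) : gT :=
  \prod_(m <- msupp f) zexpg (monexpg x y t m) f@_m.

(* The conditions under which the annihilator of [y, x] is a proper ideal.     *)
Definition admissible (gT : finGroupType) (G : {group gT}) (x y : gT) : Prop :=
  [/\ metabelian G, x \in G, y \in G & [~ y, x] != 1].

(* The proof H does not affect the set; it is there for the ideal structure.   *)
Definition annihilator (gT : finGroupType) (G : {group gT}) (x y : gT)
    (H : admissible G x y) : {pred {mpoly int[2]}} :=
  fun f => polyexpg x y [~ y, x] f == 1.

Section Evaluation.

Local Open Scope ring_scope.

Variables (V : zmodType) (a b : {additive V -> V}).
Hypothesis abC : forall v, a (b v) = b (a v).

Let mon (v : V) (m : 'X_{1..2}) : V := iter (m ord_max) b (iter (m ord0) a v).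
Let ev (v : V) (f : {mpoly int[2]}) : V := \sum_(m <- msupp f) mon v m *~ f@_m.

Lemma eval_bound v f k : (msize f <= k)%N ->
  ev v f = \sum_(m : 'X_{1..2 < k}) mon v m *~ f@_m.
Proof.
move=> le_fk; set I : subFinType _ := 'X_{1..2 < k}.
rewrite /ev (big_mksub I) ?msupp_uniq //=; last first.
  by move=> m /msize_mdeg_lt /leq_trans; apply.
by rewrite big_rmcond //= => j /memN_msupp_eq0 ->; rewrite mulr0z.
Qed.

Lemma evalB v f g : ev v (f - g) = ev v f - ev v g.
Proof.
pose k := maxn (msize (f - g)) (maxn (msize f) (msize g)).
rewrite !(@eval_bound _ _ k) ?leq_max ?leqnn ?orbT // -sumrB.
by apply: eq_bigr => m _; rewrite mcoeffB mulrzBr.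
Qed.

Lemma eval0 v : ev v 0 = 0.
Proof. by rewrite -(subrr (0 : {mpoly int[2]})) evalB subrr. Qed.

Lemma evalD v f g : ev v (f + g) = ev v f + ev v g.
Proof. by rewrite -{1}(opprK g) evalB -(sub0r g) evalB eval0 sub0r opprK. Qed.

Lemma evalZX v c m : ev v (c *: 'X_[m]) = mon v m *~ c.
Proof.
rewrite (@eval_bound _ _ (maxn (msize (c *: 'X_[m] : {mpoly int[2]})) (mdeg m).+1)).
  have lt_m : (mdeg m < maxn (msize (c *: 'X_[m] : {mpoly int[2]})) (mdeg m).+1)%N.
    by rewrite leq_max ltnSn orbT.
  rewrite (bigD1 (BMultinom lt_m)) //= mcoeffZ mcoeffX eqxx mulr1 big1 ?addr0 //.
  move=> i ne_im; rewrite mcoeffZ mcoeffX.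
  case: eqP => [e|_]; last by rewrite mulr0 mulr0z.
  by case/eqP: ne_im; apply: val_inj.
by rewrite leq_max leqnn.
Qed.

Lemma iter_addr (c : {additive V -> V}) n u v :
  iter n c (u + v) = iter n c u + iter n c v.
Proof. by elim: n => //= n ->; rewrite raddfD. Qed.

Lemma mon_is_additive m : {morph mon^~ m : u v / u + v}.
Proof. by move=> u v; rewrite /mon !iter_addr. Qed.

Lemma mon0 m : mon 0 m = 0.
Proof. by apply: (addrI (mon 0 m)); rewrite -mon_is_additive !addr0. Qed.

Lemma monMz m u c : mon (u *~ c) m = mon u m *~ c.
Proof.
have monN w : mon (- w) m = - mon w m.
  by apply: (addrI (mon w m)); rewrite -mon_is_additive !subrr mon0.
have monMn w n : mon (w *+ n) m = mon w m *+ n.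
  by elim: n => [|n IH]; rewrite ?mon0 // !mulrS mon_is_additive IH.
by case: c => n; rewrite ?NegzE ?mulrNz ?monN -!pmulrn monMn.
Qed.

Lemma iterC n p v : iter n a (iter p b v) = iter p b (iter n a v).
Proof.
have bC w : iter n a (b w) = b (iter n a w) by elim: n => //= n ->.
by elim: p => //= p IH; rewrite bC IH.
Qed.

Lemma monM v m k : mon v (m + k)%MM = mon (mon v k) m.
Proof. by rewrite /mon !mnmDE !iterD iterC. Qed.

Lemma evalM v f g : ev v (g * f) = ev (ev v f) g.
Proof.
elim/mpolyind: g => [|c m g _ _ IH]; first by rewrite mul0r !eval0.
rewrite mulrDl !evalD IH evalZX; congr (_ + _).
elim/mpolyind: f {IH} => [|d k f _ _ IHf].
  by rewrite mulr0 !eval0 mon0 mul0rz.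
rewrite mulrDr !evalD IHf evalZX mon_is_additive mulrzDl; congr (_ + _).
rewrite -scalerAl -scalerAr -mpolyXD scalerA evalZX monMz monM.
by rewrite mulrC mulrzA.
Qed.

Lemma eval_at0 f : ev 0 f = 0.
Proof. by rewrite /ev big1 // => m _; rewrite mon0 mul0rz. Qed.

Lemma eval1 v : ev v 1 = v.
Proof. by rewrite -mpolyX0 -[X in ev _ X]scale1r evalZX /mon !mnm0E. Qed.

Lemma eval_idealr v : v != 0 -> idealr_closed [pred f | ev v f == 0].
Proof.
move=> nz_v; split; rewrite ?inE ?eval0 ?eval1 //.
by move=> g f h; rewrite !inE evalD evalM => /eqP-> /eqP->; rewrite eval_at0 addr0.
Qed.

End Evaluation.

Section AbelianZmod.

Variables (gT : finGroupType) (K : {group gT}).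

Definition zmod_of (_ : abelian K) : Type := subg_of K.

Variable abK : abelian K.

HB.instance Definition _ := Finite.on (zmod_of abK).

Fact zmod_addA : associative (fun u v : zmod_of abK => (u : subg_of K) * v).
Proof. exact: mulgA. Qed.
Fact zmod_addC : commutative (fun u v : zmod_of abK => (u : subg_of K) * v).
Proof.
by move=> u v; apply: val_inj; rewrite /= (centsP abK) ?subgP.
Qed.
Fact zmod_add0 : left_id (1 : subg_of K)
  (fun u v : zmod_of abK => (u : subg_of K) * v).
Proof. exact: mul1g. Qed.
Fact zmod_addN : left_inverse (1 : subg_of K)
  (fun u : zmod_of abK => (u : subg_of K)^-1)
  (fun u v : zmod_of abK => (u : subg_of K) * v).
Proof. exact: mulVg. Qed.

HB.instance Definition _ := GRing.isZmodule.Build (zmod_of abK)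
  zmod_addA zmod_addC zmod_add0 zmod_addN.

End AbelianZmod.

Section AnnihilatorIdeal.

Variables (gT : finGroupType) (G : {group gT}) (x y : gT).
Hypothesis H : admissible G x y.

Let K : {group gT} := G^`(1)%G.
Let abK : abelian K. Proof. by case: H. Qed.
Let V : zmodType := zmod_of abK.

Let VD (u v : V) : sgval (u + v)%R = sgval u * sgval v. Proof. by []. Qed.

Let V_inj (u v : V) : sgval u = sgval v -> u = v.
Proof. by move=> e; apply: val_inj. Qed.

Let commK g t : g \in G -> t \in K -> [~ t, g] \in K.
Proof.
move=> gG tK; rewrite commgEl groupMl ?groupV // memJ_norm //.
by apply: (subsetP (der_norm 1 G)).
Qed.

Let d (g : gT) (u : V) : V := subg K [~ sgval u, g].

Let dE g (u : V) : g \in G -> sgval (d g u) = [~ sgval u, g].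
Proof. by move=> gG; rewrite subgK // commK ?subgP. Qed.

Let d_additive g : g \in G -> zmod_morphism (d g).
Proof.
move=> gG; suff dD : {morph d g : u v / (u + v)%R}.
  by move=> u v; apply/eqP; rewrite eq_sym GRing.subr_eq -dD GRing.subrK.
move=> u v; apply: V_inj; rewrite VD !dE // VD commMgJ; congr (_ * _).
by apply/conjg_fixP/commgP; apply: (centsP abK); rewrite ?commK ?subgP.
Qed.

Let dC g h u : g \in G -> h \in G -> d g (d h u) = d h (d g u).
Proof.
move=> gG hG; pose c g (u : V) : V := subg K (sgval u ^ g).
have cK g' t : g' \in G -> t \in K -> t ^ g' \in K.
  by move=> g'G tK; rewrite memJ_norm //; apply: (subsetP (der_norm 1 G)).
have dcE g' (w : V) : g' \in G -> d g' w = (c g' w - w)%R.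
  move=> g'G; rewrite GRing.addrC; apply: V_inj.
  by rewrite dE // VD /c subgK ?cK ?subgP // commgEl.
have cC : c g (c h u) = c h (c g u).
  apply: V_inj; rewrite !subgK ?cK ?subgP // -!conjgM.
  rewrite (commgC h g) (conjgM _ (g * h)); apply/conjg_fixP/commgP.
  apply: (centsP abK); first by rewrite cK ?subgP ?groupM.
  by rewrite /K /= derg1 mem_commg.
rewrite [d h u]dcE // (d_additive gG) [d g u]dcE // (d_additive hG) !dcE // cC.
by rewrite !GRing.opprB [LHS]GRing.addrACA [RHS]GRing.addrACA [X in (_ + X)%R]GRing.addrC.
Qed.

Let commX u : d x (d y u) = d y (d x u).
Proof. by case: H => _ *; apply: dC. Qed.

Let zexpgE (u : V) c : zexpg (sgval u) c = sgval (u *~ c)%R.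
Proof.
have XE n : sgval (u *+ n)%R = sgval u ^+ n.
  by elim: n => // n IH; rewrite GRing.mulrS VD IH expgS.
by case: c => n; rewrite ?NegzE ?mulrNz /= -?XE.
Qed.

Let s2 : V := subg K [~ y, x].

Let s2E : sgval s2 = [~ y, x].
Proof. by case: H => _ xG yG _; rewrite subgK // /K /= derg1 mem_commg. Qed.

Let mon (u : V) (m : 'X_{1..2}) : V :=
  iter (m ord_max) (d y) (iter (m ord0) (d x) u).

Let monE u m : monexpg x y (sgval u) m = sgval (mon u m).
Proof.
case: H => _ xG yG _; rewrite /monexpg /mon.
have iE g n v : g \in G ->
    iter n (fun w => [~ w, g]) (sgval v) = sgval (iter n (d g) v).
  by move=> gG; elim: n => //= n ->; rewrite dE.
by rewrite !iE.
Qed.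

Let polyexpgE u f : polyexpg x y (sgval u) f
  = sgval (\sum_(m <- msupp f) mon u m *~ f@_m)%R.
Proof.
rewrite /polyexpg (big_morph _ VD (erefl _)).
by apply: eq_bigr => m _; rewrite monE zexpgE.
Qed.

Fact annihilator_closed : idealr_closed (annihilator H).
Proof.
have [_ xG yG nz] := H.
have [nx ny] := (d_additive xG, d_additive yG).
pose dx := GRing.isZmodMorphism.Build V V (d x) nx.
pose dy := GRing.isZmodMorphism.Build V V (d y) ny.
pose a : {additive V -> V} := HB.pack (d x) dx.
pose b : {additive V -> V} := HB.pack (d y) dy.
have nz_s2 : (s2 != 0)%R.
  by apply: contraNneq nz => e; rewrite -s2E e.
have [h0 h1 h] := @eval_idealr V a b commX s2 nz_s2.
have aE f : (f \in annihilator H)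
    = (\sum_(m <- msupp f) mon s2 m *~ f@_m == 0 :> V)%R.
  rewrite unfold_in /annihilator -s2E polyexpgE.
  by apply/eqP/eqP => [e|->] //; apply: V_inj.
by split; rewrite ?aE // => g f k; rewrite !aE; apply: h.
Qed.

End AnnihilatorIdeal.

HB.instance Definition _ (gT : finGroupType) (G : {group gT}) (x y : gT)
    (H : admissible G x y) :=
  isIdealr.Build {mpoly int[2]} (annihilator H) (annihilator_closed H).

Lemma normalized_admissible (gT : finGroupType) (G : {group gT}) (m s : nat)
    (x y : gT) :
  metabelian G -> (3 <= nil_class G)%N -> normalized_generators G m s x y ->
  admissible G x y.
Proof.
move=> mG cG [genG _ _ _].
have xG : x \in G by rewrite -genG mem_gen ?set21.
have yG : y \in G by rewrite -genG mem_gen ?set22.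
split=> //; apply: contraL cG => /commgP cyx.
have abG : abelian G.
  rewrite -genG abelian_gen; apply/centsP => u + v.
  by rewrite !inE => /orP[]/eqP-> /orP[]/eqP->.
by rewrite -ltnNge; apply: (@leq_ltn_trans 1); rewrite ?nil_class1.
Qed.

(* The additive group of V is isomorphic to the multiplicative group H.        *)
Definition additive_isom (V : zmodType) (gT : finGroupType) (H : {group gT}) :
    Prop :=
  exists phi : V -> gT,
    [/\ {morph phi : a b / (a + b)%R >-> a * b},
        injective phi
      & forall t : gT, t \in H <-> exists a : V, phi a = t].

(* Main.v *)
Require Import Defs.
From HB Require Import structures.
From mathcomp Require Import all_boot all_order all_fingroup all_algebra.
From mathcomp Require Import all_solvable mpoly.

Set Implicit Arguments.
Unset Strict Implicit.
Unset Printing Implicit Defensive.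

(** Write u = [y, x], v = [u, x], t = [u, y] for generators x, y of G.  As a
Z[X, Y]-module, with X and Y acting on G' as w |-> [w, x] and w |-> [w, y], G'
is cyclic with generator u, and 'L_(j.+2) is the j-th power of the ideal (X, Y)
applied to u.

The orders force e = 3.  Indeed, since k = 0, some y in chi_s \ G' centralizes
'L_e.  If e = 2, then Y = 0, all the factors 'L_j / 'L_(j+1) with j >= 2 have
order at most 3 (index_lcn_le3_of_cent) and G' is too small; if both 'L_3 / 'L_4
and 'L_4 / 'L_5 had order at least 9, then G' would be too large (card_lcn_ge).
So y centralizes 'L_3, that is, X Y and Y^2 kill u; with any x that generates G
together with y, the rest follows from x^3, y^3 in G'.

Because y^3 commutes with u, (1 + Y)^3 - 1 kills u, and this says t^3 = 1.
Because X u and Y u are independent in 'L_3 / 'L_4, the cube x^3 lies in 'L_3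
(exp3_lcn3): otherwise u would be a power of x^3 modulo 'L_3 and X u would
vanish in 'L_3 / 'L_4.  Hence y commutes with x^3, and expanding [y, x^3] gives
(X^2 + 3 X + 3) u = 0 (exp3_relation).  So G' is a quotient of
Z[X, Y] / (X^2 + 3 X + 3, X Y, Y^2, 3 Y), whose additive group is Z[z] + Z/3
with z a primitive cube root of unity and X = z - 1.  In particular u, v, t
generate G' (der1_gen3), and as 3 is X^2 up to a unit of Z[z], the cube of an
element of 'L_j, j >= 2, lies in 'L_(j+2), which bounds the orders of u and v by
3^(uphalf (m - 2)) and 3^(half (m - 2)).  The product of the three bounds is the
order of G', so the evident surjection of A(3, m - 2) + C(3) onto G' is
bijective (der1_isog).

The isomorphism with the residue class ring holds for every pair of generators:
f |-> u^f is additive, its kernel is the annihilator by definition, and its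
image is stable under commutation with x and y, hence is all of G'
(annihilator_quot_isom). *)

Local Open Scope group_scope.

(** * Commutators and powers in two-generated metabelian groups *)

Section TwoGenerators.

Variables (gT : finGroupType) (G : {group gT}).

(** Modulo H the two generators commute, so G / H is abelian.  This is how
membership in G' is propagated below: a property of [y, x] that is stable under
products and conjugation holds on G'. *)
Lemma gen2_der1_sub (H : {group gT}) x y :
  <<[set x; y]>> = G -> G \subset 'N(H) -> [~ y, x] \in H -> G^`(1) \subset H.
Proof.
move=> genG nHG Hyx; apply: der1_min => //.
rewrite -genG quotient_gen; last first.
  by apply: subset_trans nHG; rewrite -genG subset_gen.
have [Nx Ny] : x \in 'N(H) /\ y \in 'N(H).
  by split; apply: (subsetP nHG); rewrite -genG mem_gen ?set21 ?set22.
have cxy : commute (coset H y) (coset H x).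
  by apply/commgP; rewrite -morphR //; apply/eqP; exact: coset_id.
rewrite /quotient morphimEsub; last by rewrite subUset !sub1set Nx.
rewrite abelian_gen; apply/centsP => _ /imsetP[a + ->] _ /imsetP[b + ->].
by rewrite !inE => /orP[]/eqP-> /orP[]/eqP->.
Qed.

(** Elements of B are central modulo H, and so is z, since it commutes modulo H
with both generators. *)
Lemma commg_cycle_mul_sub (H A B : {group gT}) x y z :
    <<[set x; y]>> = G -> H <| G -> A \subset G -> B \subset G ->
    A \subset <[z]> * B -> [~: B, G] \subset H ->
    z \in G -> [~ z, x] \in H -> [~ z, y] \in H ->
  [~: A, G] \subset H.
Proof.
move=> genG /andP[sHG nHG] sAG sBG sA sBGH Gz Hx Hy.
have Nz : z \in 'N(H) := subsetP nHG z Gz.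
rewrite -quotient_cents2 ?(subset_trans sAG) //.
apply: subset_trans (quotientS H sA) _.
rewrite quotientMl ?cycle_subG // mul_subG //; last first.
  by rewrite quotient_cents2 // (subset_trans sBG).
have [Nx Ny] : x \in 'N(H) /\ y \in 'N(H).
  by split; apply: (subsetP nHG); rewrite -genG mem_gen ?set21 ?set22.
rewrite quotient_cycle // cycle_subG -genG quotient_gen; last first.
  by rewrite subUset !sub1set Nx.
rewrite /= cent_gen /quotient morphimEsub; last by rewrite subUset !sub1set Nx.
apply/centP => _ /imsetP[a + ->].
rewrite !inE => /orP[]/eqP->; apply/commgP; rewrite -morphR //; apply/eqP;
  exact: coset_id.
Qed.

Lemma index_cyclic_le (K H : {group gT}) z p :
    0 < p -> K \subset <[z]> * H -> H <| K -> z \in 'N(H) -> z ^+ p \in H ->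
  #|K : H| <= p.
Proof.
move=> p0 sK /andP[sHK nHK] Nz Hzp; rewrite -card_quotient //.
have s : K / H \subset <[coset H z]>.
  rewrite -quotient_cycle //; apply: subset_trans (quotientS H sK) _.
  by rewrite quotientMidr.
apply: leq_trans (subset_leq_card s) _; rewrite -orderE; apply: dvdn_leq => //.
by rewrite order_dvdn -morphX //; apply/eqP; exact: coset_id.
Qed.

(** Consecutive terms of the lower central series have central quotient, so
everything in between is normal. *)
Lemma lcn_mid_norm (H : {group gT}) j :
  'L_j.+1(G) \subset H -> H \subset 'L_j(G) -> G \subset 'N(H).
Proof.
move=> sLH sHL; rewrite -commg_subl.
by apply: subset_trans (commSg _ sHL) (subset_trans (lcnSnS j G) sLH).
Qed.

Hypothesis abG' : abelian G^`(1).

Let cG' u v : u \in G^`(1) -> v \in G^`(1) -> commute u v.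
Proof. by move=> Gu Gv; apply: (centsP abG'). Qed.

Lemma der1J u g : u \in G^`(1) -> g \in G -> u ^ g \in G^`(1).
Proof. by move=> G'u Gg; rewrite memJ_norm // (subsetP (der_norm 1 G)). Qed.

Lemma der1R u g : u \in G^`(1) -> g \in G -> [~ u, g] \in G^`(1).
Proof. by move=> G'u Gg; rewrite commgEl groupMl ?groupV // der1J. Qed.

Lemma der1_commM u v g : u \in G^`(1) -> v \in G^`(1) -> g \in G ->
  [~ u * v, g] = [~ u, g] * [~ v, g].
Proof.
move=> G'u G'v Gg; rewrite commMgJ; congr (_ * _).
by apply/conjg_fixP/commgP/cG'; rewrite ?der1R.
Qed.

Lemma der1_commX u g i : u \in G^`(1) -> g \in G ->
  [~ u ^+ i, g] = [~ u, g] ^+ i.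
Proof.
move=> G'u Gg; elim: i => [|i IH]; first by rewrite comm1g.
by rewrite !expgS der1_commM ?groupX // IH.
Qed.

(** The actions of g and h on G' commute because [g, h] acts trivially on the
abelian group G'; [_, g] and [_, h] are these actions minus the identity. *)
Lemma der1_commC u g h : u \in G^`(1) -> g \in G -> h \in G ->
  [~ u, g, h] = [~ u, h, g].
Proof.
move=> G'u Gg Gh.
have E : u ^ (g * h) = u ^ (h * g).
  rewrite (commgC g h) [in LHS]conjgM; apply/conjg_fixP/commgP/cG'.
    by rewrite der1J ?groupM.
  by rewrite derg1 mem_commg.
have R a b : a \in G -> b \in G ->
    [~ u, a, b] = u * ((u^-1) ^ b * (u^-1) ^ a) * u ^ (a * b).
  move=> Ga Gb; rewrite [[~ u, a]]commgEl der1_commM ?groupV ?der1J //.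
  rewrite !commgEl invgK -!conjVg -conjgM !mulgA -[u * _ * _]mulgA.
  by rewrite -!mulgA.
by rewrite !R // E; congr (_ * _ * _); apply: cG'; rewrite der1J ?groupV.
Qed.

(** Additively, [y, x^3] is 1 + (1 + X) + (1 + X)^2 = 3 + 3 X + X^2 applied to
[y, x]. *)
Lemma comm_exp3 x y : x \in G -> y \in G ->
  [~ y, x ^+ 3] = [~ y, x] ^+ 3 * [~ y, x, x] ^+ 3 * [~ y, x, x, x].
Proof.
move=> Gx Gy; set u := [~ y, x]; set v := [~ u, x]; set w := [~ v, x].
have Gu : u \in G^`(1) by rewrite derg1 mem_commg.
have Gv : v \in G^`(1) by rewrite der1R.
have cuv : commute u v by apply: cG'.
have ux : u ^ x = u * v by rewrite /v commgEl mulKVg.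
have vx : v ^ x = v * w by rewrite /w commgEl mulKVg.
rewrite 2!expgSr expg1 !commgMJ -/u conjMg ux conjMg ux vx.
clearbody w; clearbody v; clearbody u.
rewrite !expgS !expg0 !mulg1 -!mulgA; congr (_ * (_ * _)).
by rewrite mulgA -cuv -mulgA.
Qed.

Lemma der1_exp_sub (H : {group gT}) x y n :
    <<[set x; y]>> = G -> G \subset 'N(H) -> [~ y, x] ^+ n \in H ->
  forall t, t \in G^`(1) -> t ^+ n \in H.
Proof.
move=> genG nHG Hu t Gt.
pose P := [set t in G^`(1) | t ^+ n \in H].
have gP : group_set P.
  apply/group_setP; split; first by rewrite inE group1 expg1n group1.
  move=> a b; rewrite !inE => /andP[Ga Ha] /andP[Gb Hb].
  by rewrite groupM // expgMn ?groupM //; apply: cG'.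
have [Gx Gy] : x \in G /\ y \in G by rewrite -genG !mem_gen ?set21 ?set22.
suff /subsetP/(_ t Gt) : G^`(1) \subset Group gP by rewrite !inE => /andP[].
apply: (gen2_der1_sub genG); last by rewrite !inE derg1 mem_commg.
apply/subsetP => g Gg; rewrite inE; apply/subsetP => _ /imsetP[a + ->].
rewrite !inE => /andP[Ga Ha]; rewrite der1J // -conjXg.
by rewrite memJ_norm // (subsetP nHG).
Qed.

(** The n-th power map commutes with the action of G on G', so a shift by i in
the lower central series need only be checked on the generator [y, x] of the
module G'. *)
Lemma lcn_exp x y n i : <<[set x; y]>> = G -> [~ y, x] ^+ n \in 'L_i.+2(G) ->
  forall j t, t \in 'L_j.+2(G) -> t ^+ n \in 'L_(j + i).+2(G).
Proof.
move=> genG Hu; elim=> [|j IH] t Lt.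
  exact: (der1_exp_sub genG (lcn_norm i.+2 G) Hu Lt).
pose P := [set t in G^`(1) | t ^+ n \in 'L_(j + i).+3(G)].
have gP : group_set P.
  apply/group_setP; split; first by rewrite inE group1 expg1n group1.
  move=> a b; rewrite !inE => /andP[Ga Ha] /andP[Gb Hb].
  by rewrite groupM // expgMn ?groupM //; apply: cG'.
suff /subsetP/(_ t Lt) : 'L_j.+3(G) \subset Group gP by rewrite !inE => /andP[].
rewrite lcnSn gen_subG; apply/subsetP => _ /imset2P[a g La Gg ->].
have G'a : a \in G^`(1) by rewrite -lcn2 (subsetP (lcn_sub_leq _ _) _ La).
by rewrite !inE der1R // -der1_commX // mem_commg // IH.
Qed.

End TwoGenerators.

(** * Abelian groups with three generators *)

Lemma card_Z q : 1 < q -> #|[set: 'Z_q]| = q.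
Proof. by move=> q1; rewrite cardsT card_ord Zp_cast. Qed.

Lemma p_rank_setX p (aT bT : finGroupType) :
  'r_p([set: aT * bT]) = ('r_p([set: aT]) + 'r_p([set: bT]))%N.
Proof.
have -> : [set: aT * bT] = setX [set: aT] [set: bT].
  by apply/setP=> z; rewrite !inE.
rewrite -(p_rank_dprod p (setX_dprod [set: aT]%G [set: bT]%G)).
congr (_ + _)%N; apply/esym.
  exact: (isog_p_rank (isog_setX1 _ [set: aT]%G)).
exact: (isog_p_rank (isog_set1X _ [set: bT]%G)).
Qed.

Lemma p_rank_Z p k : prime p -> 0 < k -> 'r_p([set: 'Z_(p ^ k)]) = 1%N.
Proof.
move=> pr k0.
have q1 : 1 < p ^ k by rewrite -(expn0 p) ltn_exp2l ?prime_gt1.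
have cycZ : cyclic [set: 'Z_(p ^ k)].
  by rewrite (Zp_cycle (Zp_trunc (p ^ k)).+1) cycle_cyclic.
have piZ : p \in \pi([set: 'Z_(p ^ k)]).
  by rewrite /= card_Z // pi_of_exp // pi_of_prime // inE.
apply/eqP; rewrite eqn_leq p_rank_gt0 piZ andbT.
rewrite (leq_trans (p_rank_le_rank _ _)) //.
by rewrite -abelian_rank1_cyclic ?cyclic_abelian.
Qed.

(** The three relations on the orders give a morphism from the product of cyclic
groups, which is onto since it hits the generators, and equality of the orders
makes it injective; no direct decomposition of H has to be exhibited. *)
Lemma gen3_abelian_isog (gT : finGroupType) (H : {group gT}) u v t q1 q2 q3 :
    abelian H -> <<[set u; v; t]>> = H -> 1 < q1 -> 1 < q2 -> 1 < q3 ->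
    u ^+ q1 = 1 -> v ^+ q2 = 1 -> t ^+ q3 = 1 -> #|H| = (q1 * q2 * q3)%N ->
  H \isog [set: 'Z_q1 * 'Z_q2 * 'Z_q3].
Proof.
move=> abH genH q1_gt1 q2_gt1 q3_gt1 u1 v1 t1 cardH.
have [Hu Hv Ht] : [/\ u \in H, v \in H & t \in H].
  by rewrite -genH !mem_gen // !inE eqxx ?orbT.
pose f (z : 'Z_q1 * 'Z_q2 * 'Z_q3) := u ^+ z.1.1 * v ^+ z.1.2 * t ^+ z.2.
have ZM q (w : gT) (i j : 'Z_q) : 1 < q -> w ^+ q = 1 ->
    w ^+ (i * j)%g = w ^+ i * w ^+ j.
  move=> q_gt1 w1.
  by rewrite -expgD -[in RHS](expg_mod _ w1) /= [X in _ %% X]Zp_cast.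
have fM : {in [set: _] &, {morph f : a b / a * b}}.
  move=> [[a b] c] [[a' b'] c'] _ _.
  rewrite /f /= !ZM // -!mulgA; congr (_ * _).
  have cH := centsP abH.
  rewrite [v ^+ b' * (_ * _)]mulgA (cH (v ^+ b')) ?groupX // -mulgA.
  rewrite mulgA (cH (u ^+ a')) ?groupX // -mulgA; congr (_ * _).
  by rewrite mulgA (cH (u ^+ a')) ?groupX // -mulgA.
pose phi := Morphism fM.
have im_phi : phi @* [set: _] = H.
  apply/eqP; rewrite eqEsubset; apply/andP; split.
    by apply/subsetP=> _ /morphimP[z _ _ ->]; rewrite /= /f !groupM ?groupX.
  rewrite -{1}genH gen_subG !subUset !sub1set -andbA; apply/and3P; split.
  - apply/morphimP; exists (1%R, 1, 1); rewrite ?inE //=.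
    by rewrite /f /= !mulg1 expg1.
  - apply/morphimP; exists (1, 1%R, 1); rewrite ?inE //=.
    by rewrite /f /= mul1g mulg1 expg1.
  - apply/morphimP; exists (1, 1, 1%R); rewrite ?inE //=.
    by rewrite /f /= !mul1g expg1.
rewrite isog_sym; apply/isogP; exists phi => //; rewrite -card_im_injm.
by rewrite im_phi cardH !cardsT !card_prod -!cardsT !card_Z.
Qed.

(** * The residue class ring of the annihilator *)

(** G' written additively, with [_, x] and [_, y] as commuting endomorphisms a
and b: this turns evaluation of integer polynomials at (x - 1, y - 1) into
evaluation at (a, b). *)
Lemma der1_zmodule (gT : finGroupType) (G : {group gT}) x y :
    abelian G^`(1) -> x \in G -> y \in G ->
  exists (V : zmodType) (a b : {additive V -> V}) (val : V -> gT),
    [/\ forall w, a (b w) = b (a w),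
        {morph val : w z / (w + z)%R >-> w * z},
        forall w, val (a w) = [~ val w, x],
        forall w, val (b w) = [~ val w, y]
      & injective val /\ (forall g, g \in G^`(1) <-> exists w, val w = g)].
Proof.
move=> abG' Gx Gy; pose K : {group gT} := G^`(1)%G.
have abK : abelian K by [].
pose V : zmodType := zmod_of abK; pose val (w : V) : gT := sgval w.
have valK w : val w \in G^`(1) := subgP w.
have val_inj : injective val := subg_inj (G := K).
have valD : {morph val : w z / (w + z)%R >-> w * z} by [].
pose d g (w : V) : V := subg K [~ val w, g].
have dE g w : g \in G -> val (d g w) = [~ val w, g].
  by move=> Gg; rewrite /val subgK // der1R.
have dM g : g \in G -> GRing.zmod_morphism (d g).
  move=> Gg; suff dD : {morph d g : w z / (w + z)%R}.
    by move=> w z; apply/eqP; rewrite eq_sym GRing.subr_eq -dD GRing.subrK.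
  by move=> w z; apply: val_inj; rewrite valD !dE // valD (der1_commM abG').
pose dx := GRing.isZmodMorphism.Build V V (d x) (dM x Gx).
pose dy := GRing.isZmodMorphism.Build V V (d y) (dM y Gy).
pose a : {additive V -> V} := HB.pack (d x) dx.
pose b : {additive V -> V} := HB.pack (d y) dy.
exists V, a, b, val; split=> //.
- by move=> w; apply: val_inj; rewrite !dE // (der1_commC abG').
- by move=> w; rewrite dE.
- by move=> w; rewrite dE.
split=> // g; split=> [G'g | [w <-] //].
by exists (subg K g); rewrite /val subgK.
Qed.

(** The map f |-> u^f is Z[X, Y]-linear from the polynomial ring to G'. *)
Lemma polyexpg_module (gT : finGroupType) (G : {group gT}) x y u :
    abelian G^`(1) -> x \in G -> y \in G -> u \in G^`(1) ->
  [/\ {morph polyexpg x y u : f g / (f + g)%R >-> f * g},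
      forall f, polyexpg x y u f \in G^`(1),
      polyexpg x y u 1%R = u,
      forall f, polyexpg x y u ('X_ord0 * f)%R = [~ polyexpg x y u f, x]
    & forall f, polyexpg x y u ('X_ord_max * f)%R = [~ polyexpg x y u f, y]].
Proof.
move=> abG' Gx Gy G'u.
have [V [a [b [val [abC valD vala valb [val_inj valP]]]]]] :=
  der1_zmodule abG' Gx Gy.
have [w def_u] := (valP u).1 G'u.
have val0 : val 0%R = 1.
  by apply: (mulgI (val 0%R)); rewrite -valD GRing.addr0 mulg1.
have zexpgE z c : zexpg (val z) c = val (z *~ c)%R.
  have XE i : val (z *+ i)%R = val z ^+ i.
    by elim: i => // i IH; rewrite GRing.mulrS valD IH expgS.
  case: c => i; rewrite ?NegzE ?mulrNz /= -?XE //.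
  by apply: (mulgI (val (z *+ i.+1)%R)); rewrite -valD GRing.subrr mulgV val0.
pose mon (m : 'X_{1..2}) z := iter (m ord_max) b (iter (m ord0) a z).
have monE m z : monexpg x y (val z) m = val (mon m z).
  rewrite /monexpg /mon.
  have -> : iter (m ord0) (fun t => [~ t, x]) (val z) = val (iter (m ord0) a z).
    by elim: (m ord0) => //= i ->; rewrite vala.
  by elim: (m ord_max) => //= i ->; rewrite valb.
have polyE z f : polyexpg x y (val z) f
    = val (\sum_(m <- msupp f) mon m z *~ f@_m)%R.
  rewrite (big_morph _ valD val0); apply: eq_bigr => m _.
  by rewrite monE zexpgE.
have XE i z : (\sum_(m <- msupp ('X_i : {mpoly int[2]}))
    mon m z *~ ('X_i : {mpoly int[2]})@_m)%R = mon U_(i)%MM z.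
  by have := evalZX a b z 1 U_(i)%MM; rewrite GRing.scale1r.
rewrite -def_u; split.
- by move=> f g; rewrite !polyE -valD /mon evalD.
- by move=> f; rewrite polyE; apply/valP; eexists.
- by rewrite polyE /mon eval1.
- by move=> f; rewrite !polyE (evalM abC) XE -vala /mon !mnmE.
by move=> f; rewrite !polyE (evalM abC) XE -valb /mon !mnmE.
Qed.

(** Only surjectivity is not formal.  The values u^f contain all the iterated
commutators of u with x and y; these generate a subgroup normal in G and
containing u, hence equal to G'. *)
Lemma annihilator_quot_isom (gT : finGroupType) (G : {group gT}) x y
    (adm : admissible G x y) :
  <<[set x; y]>> = G -> additive_isom {ideal_quot annihilator adm} G^`(1).
Proof.
move=> genG; have [abG' Gx Gy _] := adm; set u := [~ y, x].
have G'u : u \in G^`(1) by rewrite derg1 mem_commg.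
have [pD pG' p1 pX pY] := polyexpg_module abG' Gx Gy G'u.
have p0 : polyexpg x y u 0%R = 1.
  by apply: (mulgI (polyexpg x y u 0%R)); rewrite -pD GRing.addr0 mulg1.
have pN f : polyexpg x y u (- f)%R = (polyexpg x y u f)^-1.
  by apply: (mulgI (polyexpg x y u f)); rewrite -pD GRing.subrr mulgV.
pose phi (q : {ideal_quot annihilator adm}) :=
  polyexpg x y u (generic_quotient.repr q).
have annE f g : (f == g %[mod {ideal_quot annihilator adm}])%qT
    = (polyexpg x y u f == polyexpg x y u g).
  rewrite -Quotient.idealrBE unfold_in /annihilator -/u pD pN.
  by rewrite -eq_mulgV1.
have phi_pi f :
    phi (\pi_({ideal_quot annihilator adm}) f)%qT = polyexpg x y u f.
  by apply/eqP; rewrite -annE reprK.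
exists phi; split.
- move=> q r; rewrite -[q]reprK -[r]reprK -GRing.rmorphD !phi_pi; exact: pD.
- move=> q r /eqP; rewrite -annE !reprK => /eqP //.
move=> t; split=> [G't | [q <-]]; last exact: pG'.
suff [f <-] : exists f, polyexpg x y u f = t.
  by exists (\pi_({ideal_quot annihilator adm}) f)%qT.
(* S is the set of iterated commutators of u: the vertices reachable from u in
   the finite graph with edges from v to [v, x] and [v, y]. *)
pose r : rel gT := fun v w => (w == [~ v, x]) || (w == [~ v, y]).
pose S := [set v | connect r u v].
have S_pol v : v \in S -> exists f, polyexpg x y u f = v.
  rewrite inE => /connectP[p]; elim/last_ind: p v => [|p w IH] v /=.
    by move=> _ ->; exists 1%R.
  rewrite rcons_path last_rcons => /andP[rp rw] ->.
  have [f def_f] := IH _ rp erefl.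
  case/orP: rw => /eqP->; rewrite -def_f.
    by exists ('X_ord0 * f)%R; rewrite pX.
  by exists ('X_ord_max * f)%R; rewrite pY.
have nS : G \subset 'N(<<S>>).
  rewrite -genG gen_subG subUset !sub1set !inE -!genJ !gen_subG.
  by apply/andP; split; apply/subsetP=> _ /imsetP[v Sv ->];
     rewrite (conjg_mulR v) groupM ?mem_gen //; move: Sv; rewrite !inE => Sv;
     apply: connect_trans Sv (connect1 _); rewrite /r eqxx ?orbT.
have /subsetP/(_ t G't) : G^`(1) \subset <<S>>.
  by apply: gen2_der1_sub genG nS _; rewrite mem_gen // inE connect0.
case/gen_prodgP=> n [c Sc ->].
apply: (big_ind (fun v => exists f, polyexpg x y u f = v)).
- by exists 0%R.
- by move=> _ _ [f <-] [g <-]; exists (f + g)%R.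
by move=> i _; apply: S_pol.
Qed.

(** * The module structure of the derived subgroup *)

Section Exponent3.

Variables (gT : finGroupType) (G : {group gT}) (x y : gT).
Hypotheses (abG' : abelian G^`(1)) (genG : <<[set x; y]>> = G).
Hypotheses (x3 : x ^+ 3 \in G^`(1)) (y3 : y ^+ 3 \in G^`(1)).

Let u := [~ y, x].
Let v := [~ u, x].
Let t := [~ u, y].

Let Gx : x \in G. Proof. by rewrite -genG mem_gen ?set21. Qed.
Let Gy : y \in G. Proof. by rewrite -genG mem_gen ?set22. Qed.
Let G'u : u \in G^`(1). Proof. by rewrite derg1 mem_commg. Qed.

Let lcnR j w g : w \in 'L_j.+1(G) -> g \in G -> [~ w, g] \in 'L_j.+2(G).
Proof. by move=> Lw Gg; rewrite lcnSn mem_commg. Qed.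

Let L3v : v \in 'L_3(G). Proof. by rewrite lcnR // lcn2. Qed.
Let L3t : t \in 'L_3(G). Proof. by rewrite lcnR // lcn2. Qed.

(** Since x^3 is in G', [y, x^3] lies in 'L_3, as do v and [v, x]; the expansion
of [y, x^3] leaves u^3. *)
Lemma gen2_exp3_lcn3 : u ^+ 3 \in 'L_3(G).
Proof.
have : [~ y, x ^+ 3] \in 'L_3(G).
  by rewrite -groupV invg_comm lcnR // lcn2.
rewrite (comm_exp3 abG') // -/u -/v groupMr; last first.
  exact: (subsetP (lcn_subS 3 G)) (lcnR L3v Gx).
by rewrite groupMr // groupX.
Qed.

Let exp3S j w : w \in 'L_j.+2(G) -> w ^+ 3 \in 'L_j.+3(G).
Proof.
by move=> Lw; have := lcn_exp abG' genG gen2_exp3_lcn3 Lw; rewrite addn1.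
Qed.

Lemma der1_sub_cycle_lcn3 : G^`(1) \subset <[u]> * 'L_3(G).
Proof.
have nL3 : <[u]> \subset 'N('L_3(G)).
  by rewrite cycle_subG (subsetP (lcn_norm 3 G)) // (subsetP (der_sub 1 G)).
rewrite -norm_joinEl //; apply: gen2_der1_sub genG _ _; last first.
  by rewrite mem_gen // inE cycle_id.
apply: (@lcn_mid_norm _ _ _ 2); first exact: joing_subr.
rewrite join_subG cycle_subG; apply/andP; split; first exact: G'u.
exact: lcn_subS.
Qed.

Lemma index_lcn_le3 j z : z \in 'L_j.+2(G) ->
  'L_j.+2(G) \subset <[z]> * 'L_j.+3(G) -> #|'L_j.+2(G) : 'L_j.+3(G)| <= 3.
Proof.
move=> Lz sL; apply: index_cyclic_le sL _ _ _ => //.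
- exact: lcn_normalS.
- by apply: (subsetP (lcn_norm _ G)); apply: (subsetP (lcn_sub _ _)) Lz.
exact: exp3S.
Qed.

(** Since 'L_(j+3) is central modulo 'L_(j+4), it is generated modulo 'L_(j+4) by
[z, x] and [z, y], and here one commutator [z, g] yields both. *)
Lemma lcn_cycle_step j z g : z \in 'L_j.+2(G) ->
    'L_j.+2(G) \subset <[z]> * 'L_j.+3(G) ->
    [~ z, g] \in 'L_j.+3(G) ->
    [~ z, x] \in <[[~ z, g]]> * 'L_j.+4(G) ->
    [~ z, y] \in <[[~ z, g]]> * 'L_j.+4(G) ->
  'L_j.+3(G) \subset <[[~ z, g]]> * 'L_j.+4(G).
Proof.
move=> Lz sL Lzg.
have nL : <[[~ z, g]]> \subset 'N('L_j.+4(G)).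
  rewrite cycle_subG; apply: (subsetP (lcn_norm j.+4 G)).
  exact: (subsetP (lcn_sub j.+3 G)).
rewrite -norm_joinEl // => Hx Hy.
have sHL : <[[~ z, g]]> <*> 'L_j.+4(G) \subset 'L_j.+3(G).
  by rewrite join_subG cycle_subG Lzg lcn_subS.
rewrite {1}lcnSn; apply: (commg_cycle_mul_sub genG) sL _ _ Hx Hy.
- rewrite /normal (subset_trans sHL) ?lcn_sub //=.
  by apply: lcn_mid_norm sHL; apply: joing_subr.
- exact: lcn_sub.
- exact: lcn_sub.
- by rewrite -lcnSn joing_subr.
exact: (subsetP (lcn_sub j.+2 G)).
Qed.

(** If Y = 0 on G', then X maps 'L_j onto 'L_(j+1), so each factor is generated
by the image of a single element. *)
Lemma index_lcn_le3_of_cent : (forall w, w \in G^`(1) -> [~ w, y] = 1) ->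
  forall j, #|'L_j.+2(G) : 'L_j.+3(G)| <= 3.
Proof.
move=> cG'y j.
suff [z Lz sL] : exists2 z, z \in 'L_j.+2(G)
                          & 'L_j.+2(G) \subset <[z]> * 'L_j.+3(G).
  exact: index_lcn_le3 Lz sL.
elim: j => [|j [z Lz sL]].
  by exists u; rewrite ?lcn2 ?der1_sub_cycle_lcn3.
have Lzx := lcnR Lz Gx; exists [~ z, x] => //.
apply: lcn_cycle_step => //.
  by rewrite -[X in X \in _]mulg1 mem_mulg ?cycle_id ?group1.
rewrite cG'y -?[X in X \in _](mulg1 1) ?mem_mulg ?group1 //.
by rewrite -lcn2; apply: (subsetP (lcn_sub_leq G (isT : 2 <= j.+2))).
Qed.

Hypotheses (cL3y : forall w, w \in 'L_3(G) -> [~ w, y] = 1).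
Hypothesis L34 : 3 < #|'L_3(G) : 'L_4(G)|.

(** If x^3 were not in 'L_3, then x^3 = u^i w with w in 'L_3 and i prime to 3.
Commuting with x kills x^3, so v^i is in 'L_4, hence so is v; then 'L_3 / 'L_4
is generated by t and has order at most 3. *)
Lemma exp3_lcn3 : x ^+ 3 \in 'L_3(G).
Proof.
have /mulsgP[_ w /cycleP[i ->] Lw def_x3] := subsetP der1_sub_cycle_lcn3 _ x3.
have G'w : w \in G^`(1) by rewrite -lcn2 (subsetP (lcn_subS 2 G)).
have v3 : v ^+ 3 \in 'L_4(G) by apply: exp3S.
have vi : v ^+ i \in 'L_4(G).
  have : [~ x ^+ 3, x] = 1 by apply/eqP/commgP; apply/commute_sym/commuteX.
  rewrite def_x3 (der1_commM abG' (groupX i G'u) G'w Gx).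
  rewrite (der1_commX abG' i G'u Gx) -/v.
  move/eqP; rewrite -eq_invg_mul => /eqP Ew.
  by rewrite -groupV Ew lcnR.
have L4v : v \notin 'L_4(G).
  apply: contraL L34 => L4v; rewrite -leqNgt; apply: (@index_lcn_le3 1 t) => //.
  apply: lcn_cycle_step; rewrite ?lcn2 ?der1_sub_cycle_lcn3 //.
    by rewrite -/v -[v]mul1g mem_mulg ?group1.
  by rewrite -/t -[X in X \in _]mulg1 mem_mulg ?cycle_id ?group1.
have Ei (w' : gT) : w' ^+ i = (w' ^+ 3) ^+ (i %/ 3) * w' ^+ (i %% 3).
  by rewrite {1}(divn_eq i 3) expgD mulnC expgM.
have u3k := groupX (i %/ 3) gen2_exp3_lcn3; have v3k := groupX (i %/ 3) v3.
rewrite def_x3 (groupMr _ Lw) Ei (groupMl _ u3k).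
move: vi; rewrite Ei (groupMl _ v3k).
case: (i %% 3) (ltn_pmod i (isT : 0 < 3)) => [|[|[|//]]] _.
- by move=> _; rewrite expg0 group1.
- by rewrite !expg1 (negPf L4v).
by move=> v2; case/negP: L4v; move: v3; rewrite expgSr groupMl.
Qed.

(** This is (X^2 + 3 X + 3) u = 0, the minimal equation of z - 1 for a primitive
cube root of unity z. *)
Lemma exp3_relation : u ^+ 3 * v ^+ 3 * [~ v, x] = 1.
Proof.
rewrite -(comm_exp3 abG') //; apply/eqP; rewrite -invg_comm invg_eq1; apply/eqP.
by rewrite cL3y ?exp3_lcn3.
Qed.

(** As 3 u = - 3 X u - X^2 u and 3 X u is already in 'L_4, the cube of u drops
by two steps. *)
Lemma gen2_exp3_lcn4 : u ^+ 3 \in 'L_4(G).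
Proof.
have : u ^+ 3 * v ^+ 3 * [~ v, x] \in 'L_4(G) by rewrite exp3_relation group1.
by rewrite groupMr ?lcnR // groupMr // exp3S.
Qed.

Lemma lcn_exp3 k j w : w \in 'L_j.+2(G) -> w ^+ (3 ^ k) \in 'L_(j + k.*2).+2(G).
Proof.
move=> Lw; elim: k => [|k IH]; first by rewrite addn0.
rewrite expnSr expgM doubleS !addnS.
by have := lcn_exp abG' genG gen2_exp3_lcn4 IH; rewrite addn2.
Qed.

(** Apply the expansion of [_, y^3] to u: it is 3 t + 3 Y t + Y^2 t, and Y t = 0
because t is in 'L_3. *)
Lemma comm_uy_exp3 : t ^+ 3 = 1.
Proof.
have Gu : u \in G := subsetP (der_sub 1 G) _ G'u.
have : [~ u, y ^+ 3] = 1 by apply/eqP/commgP; apply: (centsP abG').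
by rewrite (comm_exp3 abG') // -/t (cL3y L3t) expg1n comm1g !mulg1.
Qed.

(** The span of u, v, t is stable under X and Y: X u = v, Y u = t,
X v = - 3 u - 3 v, X t = Y v = Y t = 0. *)
Lemma der1_gen3 : <<[set u; v; t]>> = G^`(1).
Proof.
set S := [set u; v; t].
have [Su Sv St] : [/\ u \in <<S>>, v \in <<S>> & t \in <<S>>].
  by rewrite !mem_gen // !inE eqxx ?orbT.
have [G'v G't] : v \in G^`(1) /\ t \in G^`(1) by split; apply: der1R.
apply/eqP; rewrite eqEsubset gen_subG !subUset !sub1set G'u G'v G't /=.
apply: (gen2_der1_sub genG) => //.
have tx : [~ t, x] = 1 by rewrite /t (der1_commC abG') // cL3y.
have vx : [~ v, x] \in <<S>>.
  have /eqP := exp3_relation; rewrite -eq_invg_mul => /eqP <-.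
  by rewrite groupV groupM ?groupX.
rewrite -genG gen_subG subUset !sub1set !inE -!genJ !gen_subG.
apply/andP; split; apply/subsetP=> _ /imsetP[w + ->];
  rewrite !inE -orbA (conjg_mulR w) => /or3P[]/eqP-> //;
  rewrite groupM // -?/v -?/t //.
- by rewrite tx.
- by rewrite cL3y.
by rewrite cL3y.
Qed.

(** The exponents come from u in 'L_2 and v in 'L_3: multiplication by 3^k
shifts the index by 2 k, and 'L_(mu + 2) is trivial. *)
Lemma der1_isog mu : 1 < mu -> 'L_mu.+2(G) = 1 -> #|G^`(1)| = (3 ^ mu.+1)%N ->
  G^`(1) \isog [set: A3 mu * C3].
Proof.
move=> mu_gt1 Lmu cardG'.
have Lge j : mu.+2 <= j -> 'L_j(G) = 1.
  by move=> le_j; apply/trivgP; rewrite -Lmu lcn_sub_leq.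
have mu2 : 0 < mu./2 by rewrite half_gt0.
have mu2' : 0 < uphalf mu by rewrite uphalf_gt0 (ltnW mu_gt1).
have ub k : 0 < k -> 1 < 3 ^ k by move=> k0; rewrite -(expn0 3) ltn_exp2l.
apply: (gen3_abelian_isog abG' der1_gen3 (ub _ mu2') (ub _ mu2)) => //.
- apply/set1gP; rewrite -(Lge (0 + (uphalf mu).*2).+2).
    by rewrite lcn_exp3 // lcn2.
  rewrite !ltnS add0n uphalf_half -{1}(odd_double_half mu).
  by rewrite doubleD leq_add2r; case: odd.
- apply/set1gP; rewrite -(Lge (1 + (mu./2).*2).+2); first by rewrite lcn_exp3.
  by rewrite !ltnS -{1}(odd_double_half mu) leq_add2r; case: odd.
- exact: comm_uy_exp3.
by rewrite cardG' -expnD uphalf_half -addnA addnn odd_double_half expnSr.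
Qed.

End Exponent3.

(** * Orders of the lower central factors *)

Lemma abelian_type33 (gT : finGroupType) (A : {group gT}) :
  abelian A -> abelian_type A = [:: 3; 3] ->
  #|A| = 9 /\ forall a, a \in A -> a ^+ 3 = 1.
Proof.
move=> abA typeA; have [b defA] := abelian_structure abA; rewrite typeA.
case: b defA => [|a [|c [|? ?]]] //.
rewrite !big_cons big_nil dprodg1 => defA [oa oc].
split; first by rewrite -(dprod_card defA) -!orderE oa oc.
move=> g; have [_ <- cac _] := dprodP defA.
case/mulsgP=> _ _ /cycleP[i ->] /cycleP[j ->] ->.
rewrite expgMn; last by apply/commute_sym/(centsP cac); rewrite mem_cycle.
rewrite -!expgM !(mulnC _ 3) !expgM.
by rewrite -[in a ^+ _]oa -[in c ^+ _]oc !expg_order !expg1n mulg1.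
Qed.

Section ThreeGroup.

Variables (gT : finGroupType) (G : {group gT}).
Hypothesis G3 : 3.-group G.

(** Any x outside the maximal subgroup generated by y and G' will do, since G'
is contained in the Frattini subgroup. *)
Lemma gen2_of_ab33 y :
    #|G : G^`(1)| = 9 -> (forall g, g \in G -> g ^+ 3 \in G^`(1)) ->
    y \in G -> y \notin G^`(1) ->
  exists x, <<[set x; y]>> = G.
Proof.
move=> iG9 G'3 Gy G'y; pose H := (<[y]> <*> G^`(1))%G.
have nG' : G \subset 'N(G^`(1)) := der_norm 1 G.
have sHG : H \subset G by rewrite join_subG cycle_subG Gy der_sub.
have sG'H : G^`(1) \subset H by apply: joing_subr.
have iH : #|H : G^`(1)| = 3.
  have le3 : #|H : G^`(1)| <= 3.
    apply: (@index_cyclic_le _ _ _ y) => //.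
    - by rewrite /= /H norm_joinEl // cycle_subG (subsetP nG').
    - by rewrite /normal sG'H (subset_trans sHG).
    - by rewrite (subsetP nG').
    exact: G'3.
  have : #|H : G^`(1)| %| 9 by rewrite -iG9 indexSg.
  have : 1 < #|H : G^`(1)|.
    rewrite indexg_gt1; apply: contra G'y => sHG'.
    by apply: (subsetP sHG'); rewrite mem_gen // inE cycle_id.
  by case: #|_ : _| le3 => [|[|[|[|]]]].
have iGH : #|G : H| = 3.
  apply/eqP; rewrite -(eqn_pmul2r (isT : 0 < 3)) -{1}iH.
  by rewrite Lagrange_index // iG9.
have [x Gx Hx] : exists2 x, x \in G & x \notin H.
  by apply/subsetPn; rewrite -indexg_gt1 iGH.
exists x; apply: Phi_nongen; pose J := ('Phi(G) <*> [set x; y])%G.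
have sG'Phi : G^`(1) \subset 'Phi(G) by rewrite (Phi_joing G3) joing_subl.
have sJG : J \subset G by rewrite join_subG Phi_sub subUset !sub1set Gx.
have sHJ : H \subset J.
  rewrite join_subG (subset_trans sG'Phi) ?joing_subl // cycle_subG andbT.
  by rewrite mem_gen // !inE eqxx !orbT.
have Jx : x \in J by rewrite mem_gen // !inE eqxx orbT.
apply/eqP; rewrite eqEsubset sJG -indexg_eq1.
have : 1 < #|J : H| by rewrite indexg_gt1; apply: contra Hx => /subsetP->.
have /eqP : (#|G : J| * #|J : H| = 3)%N by rewrite Lagrange_index.
by case: #|G : J| #|J : H| => [|[|k]] [|[|l]] //; rewrite !mulSn !addSn !addnS.
Qed.

Lemma index_lcn_pow j : exists e, #|'L_j(G) : 'L_j.+1(G)| = (3 ^ e)%N.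
Proof.
have /p_natP[e ->] : 3.-nat #|'L_j(G) : 'L_j.+1(G)|; last by exists e.
by apply: pnat_dvd (dvdn_indexg _ _) _; apply: pgroupS (lcn_sub j G) G3.
Qed.

Lemma index_lcn_ge9 j :
  3 < #|'L_j(G) : 'L_j.+1(G)| -> 9 <= #|'L_j(G) : 'L_j.+1(G)|.
Proof.
case: (index_lcn_pow j) => e ->; rewrite (ltn_exp2l 1) // => e2.
exact: (leq_pexp2l (isT : 0 < 3) e2).
Qed.

Lemma index_lcn_ge3 j : 'L_j.+1(G) <> 1 -> 3 <= #|'L_j.+1(G) : 'L_j.+2(G)|.
Proof.
move=> /eqP Lj; have : 1 < #|'L_j.+1(G) : 'L_j.+2(G)|.
  have nL : G \subset 'N_G('L_j.+1(G)) by rewrite subsetI subxx lcn_norm.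
  have := nil_comm_properl (pgroup_nil G3) (lcn_sub j.+1 G) Lj nL.
  by rewrite indexg_gt1 -lcnSn properE => /andP[].
case: (index_lcn_pow j.+1) => e ->; rewrite (ltn_exp2l 0) // => e1.
exact: (leq_pexp2l (isT : 0 < 3) e1).
Qed.

Lemma card_lcn_ge m : 'L_m(G) <> 1 ->
  forall k, k < m.+1 -> 3 ^ k <= #|'L_(m.+1 - k)(G)|.
Proof.
move=> Lm; elim=> [|k IH] km; first by rewrite cardG_gt0.
have kE : (m.+1 - k = (m - k).+1)%N by rewrite subSn ?(ltnW (km : k < m)).
have := IH (ltnW km); rewrite kE subSS => le.
rewrite -(Lagrange (lcn_subS (m - k) G)) expnSr leq_mul //.
case E: (m - k)%N => [|i].
  by move/eqP: E; rewrite subn_eq0 leqNgt (km : k < m).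
apply: index_lcn_ge3; rewrite -E => L1; apply: Lm; apply/trivgP; rewrite -L1.
by rewrite lcn_sub_leq // leq_subr.
Qed.

Lemma card_lcn_le m : (forall j, #|'L_j.+2(G) : 'L_j.+3(G)| <= 3) ->
   'L_m(G) = 1 -> forall k, k.+2 <= m -> #|'L_(m - k)(G)| <= 3 ^ k.
Proof.
move=> i3 Lm; elim=> [|k IH] km; first by rewrite subn0 Lm cards1.
have E1 : (m - k.+1 = (m - k.+3).+2)%N by rewrite !subnSK // ltnW.
have E2 : (m - k = (m - k.+3).+3)%N by rewrite -E1 (subnSK (ltnW (ltnW km))).
have := IH (ltnW km); rewrite E1 E2 => le.
by rewrite -(Lagrange (lcn_subS (m - k.+3).+2 G)) expnSr leq_mul ?i3.
Qed.

End ThreeGroup.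

(** * The main result *)

Theorem theorem6p2 (gT : finGroupType) (G : {group gT}) (n m e s k : nat)
    (G_3group : 3.-group G)
    (G_metab : metabelian G)
    (G_ab33 : abelian_type (G / G^`(1)) = [:: 3; 3]%N)
    (G_coclass : coclass G = 2%N)
    (G_order : #|G| = (3 ^ n)%N) (n_ge5 : (5 <= n)%N)
    (m_def : nilpotency_index G m)
    (G_class : nil_class G = (m - 1)%N) (class_ge3 : (3 <= nil_class G)%N)
    (m_ge4 : (4 <= m)%N) (m_n : m = (n - 1)%N)
    (e_def : CF_invariant G e)
    (s_def : s_invariant G m s)
    (k_def : defect G m e s k) (k_0 : k = 0%N) :
  [/\ G^`(1) \isog [set: A3 (m - 2) * C3],
      forall (x y : gT) (Nxy : normalized_generators G m s x y),
        let Q := {ideal_quot annihilator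
                    (normalized_admissible G_metab class_ge3 Nxy)} in
        additive_isom Q G^`(1) /\ additive_isom Q [set: A3 (m - 2) * C3]
    & 'r_3(G^`(1)) = 3].
Proof.
have abG' : abelian G^`(1) := G_metab.
have [card9 exp3] := abelian_type33 (der_abelian 0 G) G_ab33.
have iG9 : #|G : G^`(1)| = 9 by rewrite -card_quotient ?der_norm.
have G'3 g : g \in G -> g ^+ 3 \in G^`(1).
  move=> Gg; have Ng := subsetP (der_norm 1 G) g Gg.
  by apply: coset_idr; rewrite ?groupX // morphX // exp3 // mem_quotient.
have cardG' : #|G^`(1)| = (3 ^ (m - 2).+1)%N.
  have := Lagrange (der_sub 1 G); rewrite iG9 G_order => /eqP.
  have -> : n = ((m - 2).+1 + 2)%N.
    by rewrite m_n -subnDA addSnnS subnK // ltnW // ltnW.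
  by rewrite expnD eqn_pmul2r // => /eqP.
have [Lm Lm1] := m_def.
have m_gt0 : 0 < m := leq_trans (isT : 0 < 4) m_ge4.
have m_ge2 : 2 <= m := leq_trans (isT : 2 <= 4) m_ge4.
have [/andP[_ ltG'chi] _] := s_def.
have /subsetPn[y chi_y G'y] : ~~ (chi G s \subset G^`(1)).
  by case/andP: ltG'chi.
have Gy : y \in G by move: chi_y; rewrite inE => /andP[].
have [_] := k_def; rewrite k_0 subn0 Lm => comm1.
have cLe w : w \in 'L_e(G) -> [~ w, y] = 1.
  move=> Lw; apply/eqP; rewrite -invg_comm invg_eq1; apply/eqP/set1gP.
  by rewrite -comm1 mem_commg.
have [x genG] := gen2_of_ab33 G_3group iG9 G'3 Gy G'y.
have Gx : x \in G by rewrite -genG mem_gen ?set21.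
have [x3 y3] := (G'3 x Gx, G'3 y Gy).
have [/andP[e2 idx_e] min_e] := e_def.
(* The alternative is e = 2, and then y centralizes 'L_2 = G'. *)
have L34 : 3 < #|'L_3(G) : 'L_4(G)|.
  rewrite ltnNge; apply/negP => L34.
  have e_eq2 : e = 2.
    have e_le2 : e <= 2 by rewrite -ltnS; apply: min_e.
    by apply/eqP; rewrite eqn_leq e_le2 -ltnS.
  have idx_le3 := index_lcn_le3_of_cent abG' genG x3.
  have cG'y w : w \in G^`(1) -> [~ w, y] = 1.
    by rewrite -lcn2 -e_eq2; apply: cLe.
  have := card_lcn_le (idx_le3 cG'y) Lm (k := m - 2).
  have E2 : (m - (m - 2) = 2)%N by rewrite subKn.
  rewrite E2 lcn2 cardG' leq_exp2l // ltnn => abs.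
  by apply: notF; apply: abs; rewrite -addn2 subnK.
have idx4 : #|'L_4(G) : 'L_5(G)| <= 3.
  rewrite leqNgt; apply/negP => L45.
  have m5 : 4 < m.
    rewrite ltn_neqAle m_ge4 andbT; apply: contraTneq L45 => m4.
    have L4 : 'L_4(G) = 1 by rewrite m4 Lm.
    rewrite -leqNgt -divgS ?lcn_subS //= L4 cards1.
    by apply: leq_trans (leq_div _ _) _.
  have L5 : 3 ^ (m - 5) <= #|'L_5(G)|.
    have m1 : m = m.-1.+1 by rewrite prednK.
    have := card_lcn_ge G_3group Lm1 (k := m - 5); rewrite -m1 subKn //; apply.
    by rewrite ltn_subrL m_gt0.
  have L2 : 'L_2(G) <> 1.
    move=> L2; apply: Lm1; apply/trivgP; rewrite -L2 lcn_sub_leq //.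
    by rewrite -ltnS prednK // ltnW.
  have i2 := index_lcn_ge3 G_3group L2.
  have i3 := index_lcn_ge9 G_3group L34; have i4 := index_lcn_ge9 G_3group L45.
  have : 3 ^ m <= #|G^`(1)|.
    rewrite -lcn2 -(Lagrange (lcn_subS 2 G)) -(Lagrange (lcn_subS 3 G)).
    rewrite -(Lagrange (lcn_subS 4 G)).
    (* These are the lower bounds for 'L_5 and for the indices of 'L_5 in 'L_4,
       of 'L_4 in 'L_3 and of 'L_3 in 'L_2. *)
    have -> : (3 ^ m = 3 ^ (m - 5) * 9 * 9 * 3)%N.
      by rewrite -!mulnA -(expnD 3 _ 5) subnK.
    by rewrite !leq_mul.
  by rewrite cardG' leq_exp2l // -subSn // subSS leqNgt ltn_subrL m_gt0.
have e_eq3 : e = 3.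
  have e_le3 : e <= 3 by rewrite -ltnS; apply: min_e.
  apply/eqP; rewrite eqn_leq e_le3 /= ltn_neqAle eq_sym -ltnS e2 andbT.
  apply: contraTneq L34 => eq2e; rewrite -leqNgt.
  by move: idx_e; rewrite -eq2e.
have G'isog : G^`(1) \isog [set: A3 (m - 2) * C3].
  apply: (der1_isog abG' genG x3 y3) => //.
  - by rewrite -e_eq3.
  - by rewrite ltn_subRL.
  by rewrite -addn2 subnK.
split=> //.
  move=> x' y' Nxy Q; have gen' := normalized_gen Nxy.
  have isoQ : additive_isom Q G^`(1) := annihilator_quot_isom _ gen'.
  split=> //; have [phi [phiD phi_inj phi_im]] := isoQ.
  have [f injf im_f] := isogP G'isog.
  exists (fun q => f (phi q)); split.
  - move=> q r; rewrite phiD morphM //; apply/phi_im; eexists; reflexivity.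
  - move=> q r /(injmP injf) E.
    by apply: phi_inj; apply: E; apply/phi_im; eexists; reflexivity.
  move=> t; rewrite inE; split=> // _.
  have : t \in f @* G^`(1) by rewrite im_f inE.
  by case/morphimP=> g G'g _ ->; have [q <-] := (phi_im g).1 G'g; exists q.
rewrite (isog_p_rank G'isog) 2!p_rank_setX (@p_rank_Z 3 1) // !p_rank_Z //.
  by rewrite half_gt0 ltn_subRL.
by rewrite uphalf_gt0 subn_gt0 ltnW.
Qed.
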